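(* Let $\mathcal{T}_h$ be a triangular mesh of $\Omega$. Suppose that for every interior edge $e_{ij}$ of $\mathcal{T}_h$ (connecting the vertices $\boldsymbol{a}_i$ and $\boldsymbol{a}_j$), with $K$ and $K'$ denoting the two elements sharing $e_{ij}$, $$\frac{1}{2}\left[\alpha_{ij,\mathbb{D}_K^{-1}}^{K}+\alpha_{ij,\mathbb{D}_{K'}^{-1}}^{K'}+\operatorname{arccot}\left(\sqrt{\frac{\det(\mathbb{D}_K)}{\det(\mathbb{D}_{K'})}}\,\cot\big(\alpha_{ij,\mathbb{D}_K^{-1}}^{K}\big)\right)+\operatorname{arccot}\left(\sqrt{\frac{\det(\mathbb{D}_{K'})}{\det(\mathbb{D}_{K})}}\,\cot\big(\alpha_{ij,\mathbb{D}_{K'}^{-1}}^{K'}\big)\right)\right]\le\pi .$$ Then the linear finite element scheme: find $u^h\in U^h_{g^h}$ such that $$\sum_{K\in\mathcal{T}_h}|K|\,(\nabla v^h|_K)^T\,\mathbb{D}_K\,\nabla u^h|_K=\sum_{K\in\mathcal{T}_h}|K|\sum_{k=1}^m\hat w_k\,f(b_k^K)\,v^h(b_k^K)\qquad\text{for all } v^h\in U_0^h,$$ satisfies the discrete maximum principle (DMP).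
   Context: Problem: $\Omega\subset\mathbb{R}^2$ is a connected polygonal domain, $f$ and $g$ are given functions, and $\mathbb{D}=\mathbb{D}(x,y)$ is a $2\times2$ matrix-valued function that is symmetric and strictly positive definite on $\Omega$ (including the points where it is evaluated below). The boundary value problem is $-\nabla\cdot(\mathbb{D}\nabla u)=f$ in $\Omega$, $u=g$ on $\partial\Omega$. Mesh and finite element space: $\mathcal{T}_h$ is a conforming (edge-to-edge) triangulation of $\Omega$ by nondegenerate triangles (elements), with vertices $\boldsymbol{a}_1,\dots,\boldsymbol{a}_{N_v}$, ordered so that the first $N_{vi}$ are the interior vertices. $\phi_j$ is the continuous piecewise linear basis function with value $1$ at $\boldsymbol{a}_j$ and $0$ at all other vertices. $U_0^h=\operatorname{span}\{\phi_1,\dots,\phi_{N_{vi}}\}$, and $U_{g^h}^h$ is the set of functions $\sum_{j=1}^{N_v}u_j\phi_j$ with $u_j=g(\boldsymbol{a}_j)$ for $j=N_{vi}+1,\dots,N_v$. $|K|$ is the area of $K$. Quadrature: a quadrature rule on the reference triangle $\hat K$ is fixed, with nodes $\hat b_k\in\hat K$ and weights $\hat w_k\ge0$, $k=1,\dots,m$, $\sum_{k=1}^m\hat w_k=1$. For each element $K$, $F_K:\hat K\to K$ is the affine map with $F_K(\hat K)=K$, $b_k^K=F_K(\hat b_k)$, and $\mathbb{D}_K=\sum_{k=1}^m\hat w_k\,\mathbb{D}(b_k^K)$, a symmetric positive definite constant matrix. Angles: for an element $K$ with vertices $\boldsymbol{a}_i^K,\boldsymbol{a}_j^K,\boldsymbol{a}_k^K$,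 the angle opposite the edge $e_{ij}$ measured in the metric $\mathbb{D}_K^{-1}$ is $$\alpha_{ij,\mathbb{D}_K^{-1}}^K=\arccos\left(\frac{(\boldsymbol{a}_i^K-\boldsymbol{a}_k^K)^T\mathbb{D}_K^{-1}(\boldsymbol{a}_j^K-\boldsymbol{a}_k^K)}{\|\boldsymbol{a}_i^K-\boldsymbol{a}_k^K\|_{\mathbb{D}_K^{-1}}\,\|\boldsymbol{a}_j^K-\boldsymbol{a}_k^K\|_{\mathbb{D}_K^{-1}}}\right)\in(0,\pi),\qquad \|\boldsymbol{v}\|_{M}=\sqrt{\boldsymbol{v}^TM\boldsymbol{v}}.$$ The function $\operatorname{arccot}$ takes values in $(0,\pi)$. An interior edge is an edge shared by two elements. Discrete maximum principle: the scheme satisfies DMP if, whenever $f\le0$ on $\Omega$ (including at the quadrature nodes), the solution $u^h=\sum_{j}u_j\phi_j$ satisfies $\max_{\overline\Omega}u^h=\max_{\partial\Omega}u^h$, i.e. $\max_{1\le j\le N_v}u_j=\max_{N_{vi}+1\le j\le N_v}u_j$. *)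

(* Defs.v *)
From HB Require Import structures.
From mathcomp Require Import all_boot all_order all_algebra.
From mathcomp Require Import all_classical all_reals all_analysis.

Set Implicit Arguments.
Unset Strict Implicit.
Unset Printing Implicit Defensive.

Import Order.TTheory GRing.Theory Num.Theory.
Import numFieldNormedType.Exports.

Local Open Scope classical_set_scope.
Local Open Scope ring_scope.

Section Defs.
Context {R : realType}.

Local Notation pt := 'cV[R]_2.

Definition dot (x y : pt) : R := (x^T *m y) 0 0.

Definition spd (M : 'M[R]_2) : Prop :=
  M^T = M /\ forall x : pt, x != 0 -> 0 < dot x (M *m x).

Definition mnorm (M : 'M[R]_2) (v : pt) : R := Num.sqrt (dot v (M *m v)).

Definition cot (x : R) : R := cos x / sin x.

(* The branch of arccot with values in (0, pi). *)
Definition arccot (x : R) : R := pi / 2 - atan x.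

(* The angle at c of the triangle a, b, c (opposite the edge [a, b]), measured
   in the metric M. *)
Definition angle (M : 'M[R]_2) (a b c : pt) : R :=
  acos (dot (a - c) (M *m (b - c)) / (mnorm M (a - c) * mnorm M (b - c))).

Definition is_max (A : set R) (M : R) : Prop := A M /\ ubound A M.

Definition bdry (A : set pt) : set pt := closure A `\` interior A.

Definition segment (p q : pt) : set pt :=
  [set x | exists2 t : R, 0 <= t <= 1 & x = (1 - t) *: p + t *: q].

Definition polygonal_domain (Omega : set pt) : Prop :=
  [/\ Omega !=set0, open Omega, connected Omega, bounded_set Omega &
      exists s : seq (pt * pt),
        bdry Omega = [set x | exists2 e, e \in s & segment e.1 e.2 x]].

(* Convex hull of the points p i, i in S; it is empty when S is. *)
Definition chull n (p : 'I_n -> pt) (S : {set 'I_n}) : set pt :=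
  [set x | exists l : 'I_n -> R,
     [/\ forall i, 0 <= l i, forall i, i \notin S -> l i = 0,
         \sum_i l i = 1 & x = \sum_i l i *: p i]].

(* Determinant of the matrix whose columns are p 1 - p 0 and p 2 - p 0: twice
   the signed area of the triangle p. *)
Definition tri_det (p : 'I_3 -> pt) : R :=
  \det (\matrix_(i < 2, j < 2) (p (lift ord0 j) - p ord0) i 0).

Definition tri_area (p : 'I_3 -> pt) : R := `|tri_det p| / 2.

Definition centroid (p : 'I_3 -> pt) : pt := 3^-1 *: \sum_i p i.

(* The element K has the vertices vert (elt K i), i < 3. *)
Record mesh := Mesh {
  nvert : nat;
  vert : 'I_nvert -> pt;
  nelt : nat;
  elt : 'I_nelt -> 'I_3 -> 'I_nvert }.

Section Mesh.
Variables (Omega : set pt) (T : mesh).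

Definition evert (K : 'I_(nelt T)) (i : 'I_3) : pt := vert (elt K i).

Definition vset (K : 'I_(nelt T)) : {set 'I_(nvert T)} :=
  finset (fun v => v \in codom (elt K)).

Definition tri (K : 'I_(nelt T)) : set pt := chull (@vert T) (vset K).

(* The last clause is edge-to-edge conformity: as distinct elements have
   distinct vertex sets, they meet in the empty set, in a common vertex or in
   a common edge. *)
Definition triangulation : Prop :=
  [/\ injective (@vert T),
      forall v : 'I_(nvert T), exists K, v \in vset K,
      forall K, tri_det (evert K) != 0,
      closure Omega = \bigcup_K tri K &
      forall K K', K != K' ->
        vset K != vset K' /\
        tri K `&` tri K' = chull (@vert T) (finset.setI (vset K) (vset K'))].

Definition affine_on (A : set pt) (v : pt -> R) : Prop :=
  exists (p : pt) (c : R), forall x, A x -> v x = dot p x + c.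

Definition hat_functions (phi : 'I_(nvert T) -> pt -> R) : Prop :=
  forall j, [/\ {within closure Omega, continuous (phi j)},
    forall K, affine_on (tri K) (phi j) &
    forall i, phi j (vert i) = (i == j)%:R].

(* The gradient of v|_K for v affine on K: it is constant on the interior of K
   and evaluated at the centroid. *)
Definition grad_on (K : 'I_(nelt T)) (v : pt -> R) : pt :=
  \col_i 'D_(delta_mx i 0 : pt) v (centroid (evert K)).

Variable phi : 'I_(nvert T) -> pt -> R.

Definition fe_fun (c : 'I_(nvert T) -> R) : pt -> R :=
  fun x => \sum_j c j * phi j x.

Definition U0 : set (pt -> R) :=
  [set v | exists2 c, forall j, bdry Omega (vert j) -> c j = 0 & v = fe_fun c].

Definition Ug (g : pt -> R) : set (pt -> R) :=
  [set v | exists2 c, forall j, bdry Omega (vert j) -> c j = g (vert j) &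
                      v = fe_fun c].

End Mesh.

(* rvert and rnode are the vertices and nodes on the reference triangle. *)
Record quadrature := Quadrature {
  rvert : 'I_3 -> pt;
  nnode : nat;
  rnode : 'I_nnode -> pt;
  weight : 'I_nnode -> R }.

Definition rtri (Q : quadrature) : set pt := chull (rvert Q) finset.setT.

Definition quadrature_rule (Q : quadrature) : Prop :=
  [/\ tri_det (rvert Q) != 0, forall k, rtri Q (@rnode Q k),
      forall k, 0 <= @weight Q k & \sum_k @weight Q k = 1].

Section Scheme.
Variables (Omega : set pt) (T : mesh) (phi : 'I_(nvert T) -> pt -> R).
Variables (Q : quadrature) (F : 'I_(nelt T) -> pt -> pt).
Variables (D : pt -> 'M[R]_2) (f g : pt -> R).

Definition element_maps : Prop :=
  forall K, F K @` rtri Q = tri K /\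
    exists (A : 'M[R]_2) (b : pt), forall x, F K x = A *m x + b.

Definition node (K : 'I_(nelt T)) (k : 'I_(nnode Q)) : pt := F K (rnode k).

Definition DK (K : 'I_(nelt T)) : 'M[R]_2 := \sum_k weight k *: D (node K k).

Definition area (K : 'I_(nelt T)) : R := tri_area (evert K).

Definition fe_solution (u : pt -> R) : Prop :=
  Ug Omega phi g u /\
  forall v, U0 Omega phi v ->
    \sum_K area K * dot (grad_on K v) (DK K *m grad_on K u) =
    \sum_K area K * \sum_k weight k * f (node K k) * v (node K k).

Definition DMP : Prop :=
  (forall x, Omega x -> f x <= 0) ->
  (forall K k, f (node K k) <= 0) ->
  forall u, fe_solution u ->
    (exists M, is_max (u @` closure Omega) M /\ is_max (u @` bdry Omega) M) /\
    (exists M, is_max [set u (vert j) | j in @setT 'I_(nvert T)] M /\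
       is_max [set u (vert j) | j in [set j | bdry Omega (@vert T j)]] M).

(* The interior edge shared by K and K' has the endpoints evert K i and
   evert K j; the vertices opposite to it are evert K k and evert K' k'. *)
Definition interior_edge (K K' : 'I_(nelt T)) (i j k i' j' k' : 'I_3) : Prop :=
  [/\ K != K', uniq [:: i; j; k], uniq [:: i'; j'; k'],
      elt K i = elt K' i' & elt K j = elt K' j'].

Definition edge_angle (K : 'I_(nelt T)) (i j k : 'I_3) : R :=
  angle (invmx (DK K)) (evert K i) (evert K j) (evert K k).

End Scheme.
End Defs.

Arguments mesh : clear implicits.
Arguments quadrature : clear implicits.

(* Main.v *)
(* Off the diagonal the stiffness matrix is a sum over the elements K containing
   the edge, with terms |K| grad(phi_i)^T D_K grad(phi_j)
   = - sqrt(det D_K) cot(alpha) / 2.  Since arccot is decreasing, the angle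
   condition forces sqrt(det D_K) cot(alpha) + sqrt(det D_K') cot(alpha') >= 0.
   Near an interior vertex the elements cover a neighbourhood, so every edge
   at such a vertex lies in an element on either side of it, hence in exactly
   two elements, and the off-diagonal entries of its row are nonpositive.
   Let m be the largest boundary nodal value and e the positive part of u - m.
   Testing with e gives a(e, e) <= 0, so e is constant on each element and the
   set {e > 0} of vertices is closed under sharing an element.  If nonempty, it
   contains a boundary vertex: one with the largest abscissa, since an
   interior one would share an element with points further to the right.
   But e = 0 at boundary vertices. *)
Require Import Defs.
From mathcomp Require Import all_boot all_order all_algebra.
From mathcomp Require Import all_classical all_reals all_analysis.
From mathcomp Require Import ring lra.
Import Order.TTheory GRing.Theory Num.Theory.
Import numFieldNormedType.Exports.
Local Open Scope classical_set_scope.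
Local Open Scope ring_scope.
Set Implicit Arguments.
Unset Strict Implicit.
Unset Printing Implicit Defensive.

(** * Plane geometry and barycentric coordinates *)

Section Plane.
Context {R : realType}.
Local Notation pt := 'cV[R]_2.

Definition cross (v w : pt) : R := v 0 0 * w 1 0 - v 1 0 * w 0 0.

Lemma pt_eq (x y : pt) : x 0 0 = y 0 0 -> x 1 0 = y 1 0 -> x = y.
Proof.
move=> e0 e1; apply/matrixP => i j; rewrite ord1 {j}.
case: i => [[|[|//]] Hi].
- by rewrite (_ : Ordinal Hi = 0) //; apply/val_inj.
- by rewrite (_ : Ordinal Hi = 1) //; apply/val_inj.
Qed.

Lemma dotE (v w : pt) : dot v w = v 0 0 * w 0 0 + v 1 0 * w 1 0.
Proof.
rewrite /dot !mxE !big_ord_recl big_ord0 !mxE addr0.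
by congr (_ * _ + _ * _); congr (_ _ _); apply/val_inj.
Qed.

Lemma dotZr (v w : pt) e : dot v (e *: w) = e * dot v w.
Proof. by rewrite /dot -scalemxAr mxE. Qed.

Lemma dotZl (v w : pt) e : dot (e *: v) w = e * dot v w.
Proof. by rewrite /dot linearZ -scalemxAl mxE. Qed.

Lemma dot_suml (I : finType) (F : I -> pt) w :
  dot (\sum_i F i) w = \sum_i dot (F i) w.
Proof. by rewrite /dot linear_sum mulmx_suml summxE. Qed.

Lemma dot_sumr (I : finType) v (F : I -> pt) :
  dot v (\sum_i F i) = \sum_i dot v (F i).
Proof. by rewrite /dot mulmx_sumr summxE. Qed.

Lemma dot_delta (v : pt) i : dot v (delta_mx i 0) = v i 0.
Proof.
rewrite /dot mxE (bigD1 i) //= !mxE !eqxx mulr1 big1 ?addr0 // => j ji.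
by rewrite !mxE (negPf ji) mulr0.
Qed.

Lemma dot_bilin (I J : finType) (M : 'M[R]_2) (a : I -> R) (b : J -> R)
    (x : I -> pt) (y : J -> pt) :
  dot (\sum_i a i *: x i) (M *m \sum_j b j *: y j) =
  \sum_i \sum_j a i * b j * dot (x i) (M *m y j).
Proof.
rewrite dot_suml; apply: eq_bigr => i _.
rewrite mulmx_sumr dot_sumr; apply: eq_bigr => j _.
by rewrite dotZl -scalemxAr dotZr mulrA.
Qed.

Lemma mulmx2E (M : 'M[R]_2) (v : pt) i :
  (M *m v) i 0 = M i 0 * v 0 0 + M i 1 * v 1 0.
Proof.
rewrite !mxE !big_ord_recl big_ord0 addr0.
by congr (_ * _ + _ * _); congr (_ _ _); apply/val_inj.
Qed.

Lemma det2E (M : 'M[R]_2) : \det M = M 0 0 * M 1 1 - M 0 1 * M 1 0.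
Proof.
rewrite (expand_det_row _ 0) !big_ord_recl big_ord0 /cofactor !det_mx11 !mxE /=.
rewrite !add0n expr0 expr1 addr0 mul1r mulN1r mulrN.
by congr (M _ _ * M _ _ - M _ _ * M _ _); apply/val_inj.
Qed.

Lemma tri_detE (p : 'I_3 -> pt) : tri_det p = cross (p 1 - p 0) (p 2 - p 0).
Proof.
rewrite /tri_det /cross det2E !mxE.
have -> : lift ord0 0 = 1 :> 'I_3 by apply/val_inj.
have -> : lift ord0 1 = 2 :> 'I_3 by apply/val_inj.
by rewrite [X in _ - X]mulrC.
Qed.

Lemma ord3_ind (P : 'I_3 -> Prop) : P 0 -> P 1 -> P 2 -> forall i, P i.
Proof.
move=> P0 P1 P2 [[|[|[|//]]] Hi].
- by rewrite (_ : Ordinal Hi = 0) //; apply/val_inj.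
- by rewrite (_ : Ordinal Hi = 1) //; apply/val_inj.
- by rewrite (_ : Ordinal Hi = 2) //; apply/val_inj.
Qed.

Lemma sum3 (V : nmodType) (F : 'I_3 -> V) : \sum_i F i = F 0 + F 1 + F 2.
Proof.
rewrite !big_ord_recl big_ord0 addr0 addrA.
by congr (F _ + F _ + F _); apply/val_inj.
Qed.

Lemma ord3_addE :
 (((0 + 1 = 1 :> 'I_3)%R * (0 + 2 = 2 :> 'I_3)%R) *
  ((1 + 1 = 2 :> 'I_3)%R * (1 + 2 = 0 :> 'I_3)%R) *
  ((2 + 1 = 0 :> 'I_3)%R * (2 + 2 = 1 :> 'I_3)%R))%type.
Proof. by do !split; apply/val_inj. Qed.

(** Barycentric coordinates as ratios of signed areas, with indices taken modulo 3 in ['I_3]. They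
    are defined on the whole plane and are negative beyond the edge opposite to vertex [i]. *)
Definition bary (p : 'I_3 -> pt) (i : 'I_3) (x : pt) : R :=
  cross (p (i + 1) - x) (p (i + 2) - x) / tri_det p.

(** The constant gradient of [bary p i]: the edge opposite to vertex [i], turned by a right angle
    and divided by [tri_det p]. *)
Definition gbary (p : 'I_3 -> pt) (i : 'I_3) : pt :=
  (tri_det p)^-1 *: \col_r (if r == 0 then p (i + 1) 1 0 - p (i + 2) 1 0
                           else p (i + 2) 0 0 - p (i + 1) 0 0).

Lemma baryD (p : 'I_3 -> pt) i x y :
  bary p i (x + y) = bary p i x + dot (gbary p i) y.
Proof. rewrite /bary dotE /gbary /cross !mxE /=; ring. Qed.

Lemma bary_comb (p : 'I_3 -> pt) (t : 'I_3 -> R) : tri_det p != 0 ->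
  \sum_i t i = 1 -> forall i, bary p i (\sum_m t m *: p m) = t i.
Proof.
move=> d0; rewrite sum3 => t1 i.
have t2 : t 2 = 1 - t 0 - t 1 by rewrite -t1; ring.
rewrite /bary sum3; apply: (mulIf d0); rewrite divfK //.
move: i; apply: ord3_ind; rewrite ?ord3_addE tri_detE /cross !mxE t2; ring.
Qed.

Lemma bary_sum (p : 'I_3 -> pt) x : tri_det p != 0 -> \sum_i bary p i x = 1.
Proof.
move=> d0; rewrite sum3 /bary -!mulrDl; apply: (mulIf d0); rewrite divfK //.
rewrite ?ord3_addE tri_detE /cross !mxE; ring.
Qed.

Lemma bary_point (p : 'I_3 -> pt) x : tri_det p != 0 ->
  \sum_i bary p i x *: p i = x.
Proof.
move=> d0; have E i c : bary p i x * c * tri_det p =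
    cross (p (i + 1) - x) (p (i + 2) - x) * c by rewrite mulrAC divfK.
apply: pt_eq; rewrite sum3 !mxE; apply: (mulIf d0); rewrite !mulrDl !E;
  rewrite ?ord3_addE tri_detE /cross !mxE; ring.
Qed.

Lemma sum_gbary (p : 'I_3 -> pt) : \sum_i gbary p i = 0.
Proof.
apply: pt_eq; rewrite sum3 !mxE ?ord3_addE /=; ring.
Qed.

End Plane.

(** * Angles and local stiffness *)

Section Angle.
Context {R : realType}.
Local Notation pt := 'cV[R]_2.

Lemma cot_acos (x : R) : -1 < x < 1 -> cot (acos x) = x / Num.sqrt (1 - x ^+ 2).
Proof.
move=> /andP[x1 x2]; have x12 : -1 <= x <= 1 by rewrite !ltW.
by rewrite /cot sin_acos // acosK // in_itv /=.
Qed.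

(** The cotangent of [x] is the tangent of [pi / 2 - x], which lies in the range of [atan]. *)
Lemma arccot_cot (x : R) : 0 < x < pi -> arccot (cot x) = x.
Proof.
move=> /andP[x0 xp]; rewrite /arccot /cot.
have -> : cos x / sin x = tan (- (x - pi / 2)).
  by rewrite /tan cosN sinN cosBpihalf sinBpihalf opprK.
by rewrite tanK ?in_itv /=; lra.
Qed.

Lemma arccotN (x : R) : arccot (- x) = pi - arccot x.
Proof. by rewrite /arccot atanN; field. Qed.

Lemma arccot_lt (x y : R) : x < y -> arccot y < arccot x.
Proof. by move=> xy; rewrite /arccot ltrD2l ltrN2 lt_atan. Qed.

(** By contraposition: if the sum were negative, monotonicity of [arccot] would make its two values
    exceed [pi - a'] and [pi - a], so the four terms would add up to more than [2 * pi]. *)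
Lemma cot_sum_ge0 (a a' d d' : R) : 0 < a < pi -> 0 < a' < pi ->
  0 < d -> 0 < d' ->
  (a + a' + arccot (Num.sqrt (d / d') * cot a)
     + arccot (Num.sqrt (d' / d) * cot a')) / 2 <= pi ->
  0 <= Num.sqrt d * cot a + Num.sqrt d' * cot a'.
Proof.
move=> ha ha' d0 d'0; rewrite !sqrtrM ?(ltW d0) ?(ltW d'0) //.
rewrite !sqrtrV ?(ltW d0) ?(ltW d'0) // => le_pi.
rewrite leNgt; apply/negP => lt0.
have s0 : 0 < Num.sqrt d by rewrite sqrtr_gt0.
have s'0 : 0 < Num.sqrt d' by rewrite sqrtr_gt0.
have /arccot_lt : Num.sqrt d / Num.sqrt d' * cot a < - cot a'.
  by rewrite mulrAC ltr_pdivrMr //; lra.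
have /arccot_lt : Num.sqrt d' / Num.sqrt d * cot a' < - cot a.
  by rewrite mulrAC ltr_pdivrMr //; lra.
by rewrite !arccotN !arccot_cot //; lra.
Qed.

Lemma spd_convex (n : nat) (w : 'I_n -> R) (M : 'I_n -> 'M[R]_2) :
  (forall k, 0 <= w k) -> \sum_k w k = 1 -> (forall k, spd (M k)) ->
  spd (\sum_k w k *: M k).
Proof.
move=> w0 w1 sM; split=> [|x x0].
  by rewrite linear_sum; apply: eq_bigr => k _; rewrite linearZ /= (sM k).1.
have E : dot x ((\sum_k w k *: M k) *m x) = \sum_k w k * dot x (M k *m x).
  rewrite mulmx_suml dot_sumr; apply: eq_bigr => k _.
  by rewrite -scalemxAl dotZr.
have t0 k : 0 <= w k * dot x (M k *m x).
  by rewrite mulr_ge0 // ltW //; apply: (sM k).2.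
(* Some weights may be zero, so strictness is not termwise: a zero sum would force every weight to
   vanish, against their total of 1. *)
rewrite E lt_def sumr_ge0 // andbT; apply/eqP => /psumr_eq0P z.
have : \sum_k w k = 0.
  apply: big1 => k _; have /eqP := z (fun k _ => t0 k) k isT.
  by rewrite mulf_eq0 (gt_eqF ((sM k).2 _ x0)) orbF => /eqP.
by rewrite w1 => /eqP; rewrite oner_eq0.
Qed.

Lemma spd_coef (M : 'M[R]_2) : spd M ->
  [/\ M 1 0 = M 0 1, 0 < M 0 0 & 0 < \det M].
Proof.
move=> [sM pM]; have M10 : M 1 0 = M 0 1 by rewrite -[in LHS]sM mxE.
have E (x y : R) : (x != 0) || (y != 0) ->
    0 < M 0 0 * x ^+ 2 + M 0 1 * x * y *+ 2 + M 1 1 * y ^+ 2.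
  move=> xy0; have /pM : \col_(i < 2) (if i == 0 then x else y) != 0 :> pt.
    apply: contraTneq xy0 => /matrixP z0; move: (z0 0 0) (z0 1 0).
    by rewrite !mxE /= => -> ->; rewrite eqxx.
  by rewrite dotE !mulmx2E !mxE /= M10; congr (_ < _); ring.
have M00 : 0 < M 0 0.
  have := E 1 0; rewrite oner_neq0 expr1n !mulr1 expr0n.
  by rewrite !mulr0 mul0rn !addr0; apply.
split => //.
(* At this vector the quadratic form takes the value [M 0 0 * \det M]. *)
have := E (- M 0 1) (M 0 0); rewrite (gt_eqF M00) orbT => /(_ isT) E1.
by rewrite -(pmulr_rgt0 _ M00) det2E M10; move: E1; congr (_ < _); ring.
Qed.

Lemma dot_invmx (M : 'M[R]_2) (v w : pt) : spd M ->
  dot v (invmx M *m w) = (M 1 1 * (v 0 0 * w 0 0) + M 0 0 * (v 1 0 * w 1 0)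
     - M 0 1 * (v 0 0 * w 1 0 + v 1 0 * w 0 0)) / \det M.
Proof.
move=> /spd_coef[M10 _ dM]; have d0 := lt0r_neq0 dM.
have uM : M \in unitmx by rewrite unitmxE unitfE.
(* The inverse applied to [w], written with the adjugate of the symmetric matrix [M]. *)
pose z : pt := (\det M)^-1 *:
  \col_i (if i == 0 then M 1 1 * w 0 0 - M 0 1 * w 1 0
          else M 0 0 * w 1 0 - M 0 1 * w 0 0).
have wE : w = M *m z.
  have d1 : M 0 0 * M 1 1 - M 0 1 * M 0 1 != 0 by rewrite -{2}M10 -det2E.
  by apply: pt_eq; rewrite mulmx2E !mxE /= det2E M10; field.
rewrite {1}wE mulKmx // dotE !mxE /=; ring.
Qed.

(** The Gram determinant of the two sides in the metric [invmx M] is their squared cross product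
    over [\det M]. Its positivity makes Cauchy-Schwarz strict, so the angle is neither 0 nor [pi],
    and it also gives the sine. *)
Lemma cot_angle (M : 'M[R]_2) (a b c : pt) : spd M ->
  cross (a - c) (b - c) != 0 ->
  0 < angle (invmx M) a b c < pi /\
  cot (angle (invmx M) a b c) =
    Num.sqrt (\det M) * dot (a - c) (invmx M *m (b - c))
      / `|cross (a - c) (b - c)|.
Proof.
move=> sM; rewrite /angle /mnorm.
set v := a - c; set w := b - c => c0.
have [M10 M00 dM] := spd_coef sM.
have A_ge0 (z : pt) : 0 <= dot z (invmx M *m z).
  rewrite dot_invmx //; apply: divr_ge0; last exact: ltW.
  rewrite -(pmulr_rge0 _ M00).
  (* Completing the square shows that the form is nonnegative. *)
  have -> : M 0 0 * (M 1 1 * (z 0 0 * z 0 0) + M 0 0 * (z 1 0 * z 1 0) -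
      M 0 1 * (z 0 0 * z 1 0 + z 1 0 * z 0 0)) =
      (M 0 0 * z 1 0 - M 0 1 * z 0 0) ^+ 2 + \det M * z 0 0 ^+ 2.
    by rewrite det2E M10; ring.
  by rewrite addr_ge0 ?sqr_ge0 // mulr_ge0 ?sqr_ge0 // ltW.
move: (A_ge0 v) (A_ge0 w).
set A := dot v (invmx M *m v); set B := dot w (invmx M *m w).
set s := dot v (invmx M *m w) => Age0 Bge0.
have ABs : A * B = s ^+ 2 + cross v w ^+ 2 / \det M.
  have d1 : M 0 0 * M 1 1 - M 0 1 * M 0 1 != 0.
    by rewrite -{2}M10 -det2E gt_eqF.
  by rewrite /A /B /s !dot_invmx // det2E M10 /cross; field.
have q0 : 0 < cross v w ^+ 2 / \det M by rewrite divr_gt0 // exprn_even_gt0.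
have AB0 : 0 < A * B by rewrite ABs ltr_wpDl // sqr_ge0.
have A0 : 0 < A.
  rewrite lt_def Age0 andbT; apply: contraTneq AB0 => ->.
  by rewrite mul0r ltxx.
have B0 : 0 < B.
  rewrite lt_def Bge0 andbT; apply: contraTneq AB0 => ->.
  by rewrite mulr0 ltxx.
set x := s / _.
have x2 : 1 - x ^+ 2 = cross v w ^+ 2 / \det M / (A * B).
  rewrite /x expr_div_n exprMn !sqr_sqrtr ?ltW //.
  have -> : cross v w ^+ 2 / \det M = A * B - s ^+ 2 by rewrite ABs; ring.
  by field; rewrite !gt_eqF.
have x1 : -1 < x < 1.
  rewrite -ltr_norml -(@expr_lt1 _ 2) // real_normK ?num_real //.
  by rewrite -subr_gt0 x2 divr_gt0.
split.
  case/andP: (x1) => x3 x4.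
  by rewrite acos_gt0 ?acos_ltpi // ?x3 ?x4 ?andbT /= ltW.
rewrite cot_acos // x2 sqrtrM; last exact: ltW.
rewrite sqrtrM ?sqr_ge0 // sqrtr_sqr !sqrtrV ?ltW // sqrtrM ?ltW // /x.
by field; rewrite normr_eq0 c0 !sqrtr_eq0 -!ltNge A0 B0 dM.
Qed.

Lemma uniq_ord3 (i j k : 'I_3) : uniq [:: i; j; k] ->
  (j = i + 1 /\ k = i + 2) \/ (j = i + 2 /\ k = i + 1).
Proof.
by move: i j k; do 3 (apply: ord3_ind); rewrite ?ord3_addE // => _;
  [left|right|right|left|left|right].
Qed.

Lemma cross_cyc (p : 'I_3 -> pt) i :
  cross (p i - p (i + 2)) (p (i + 1) - p (i + 2)) = tri_det p.
Proof.
by move: i; apply: ord3_ind; rewrite ?ord3_addE tri_detE /cross !mxE; ring.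
Qed.

Lemma cross_norm (p : 'I_3 -> pt) i j k : uniq [:: i; j; k] ->
  `|cross (p i - p k) (p j - p k)| = `|tri_det p|.
Proof.
case/uniq_ord3=> -[-> ->]; first by rewrite cross_cyc.
by rewrite -(cross_cyc p i) -normrN /cross !mxE; congr `|_|; ring.
Qed.

(** One formula serves both orientations: an odd ordering reverses the edge vector and the sign of
    [d] together. *)
Lemma gbaryE (p : 'I_3 -> pt) i j k : uniq [:: i; j; k] ->
  let d := cross (p i - p k) (p j - p k) in
  gbary p i 0 0 = (p j - p k) 1 0 / d /\
  gbary p i 1 0 = - (p j - p k) 0 0 / d.
Proof.
case/uniq_ord3=> -[-> ->]; rewrite /gbary !mxE /=.
  by rewrite cross_cyc; split; ring.
have -> : cross (p i - p (i + 1)) (p (i + 2) - p (i + 1)) = - tri_det p.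
  by rewrite -(cross_cyc p i) /cross !mxE; ring.
by rewrite invrN; split; ring.
Qed.

(** The gradients are edges turned by a right angle, and conjugating a symmetric 2 by 2 matrix by
    that rotation gives [\det M] times its inverse. The product thus becomes the one in [cot_angle];
    the minus sign comes from the opposite orientations of the two edges. *)
Lemma stiffness_cot (p : 'I_3 -> pt) (M : 'M[R]_2) i j k : spd M ->
  tri_det p != 0 -> uniq [:: i; j; k] ->
  tri_area p * dot (gbary p i) (M *m gbary p j) =
  - (Num.sqrt (\det M) * cot (angle (invmx M) (p i) (p j) (p k))) / 2.
Proof.
move=> sM p0 u.
have c0 : cross (p i - p k) (p j - p k) != 0.
  by rewrite -normr_eq0 (cross_norm _ u) normr_eq0.
have u' : uniq [:: j; i; k].
  move: u; rewrite /= !inE !negb_or (eq_sym i j); case: (j == i) => //=.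
  by rewrite !andbT andbC.
have [M10 M00 dM] := spd_coef sM.
rewrite (cot_angle sM c0).2 dot_invmx // dotE !mulmx2E.
have [/= -> ->] := gbaryE p u; have [/= -> ->] := gbaryE p u'.
rewrite /tri_area -(cross_norm p u).
have -> : cross (p j - p k) (p i - p k) = - cross (p i - p k) (p j - p k).
  by rewrite /cross; ring.
move: c0; set c := cross _ _ => c0.
have dq : \det M = Num.sqrt (\det M) ^+ 2 by rewrite sqr_sqrtr ?ltW.
have q0 : Num.sqrt (\det M) != 0 by rewrite sqrtr_eq0 -ltNge.
move: dq q0; set q := Num.sqrt _ => -> q0.
by rewrite M10; case: (ger0P c) => _; field; rewrite c0 q0.
Qed.

End Angle.

(** * Elements and edges of a triangulation *)

Section Triangle.
Context {R : realType}.
Local Notation pt := 'cV[R]_2.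

Lemma bary_vertex (p : 'I_3 -> pt) i k : tri_det p != 0 ->
  bary p i (p k) = (i == k)%:R.
Proof.
move=> p0; have -> : p k = \sum_m (m == k)%:R *: p m.
  rewrite (bigD1 k) //= eqxx scale1r big1 ?addr0 // => m /negPf ->.
  by rewrite scale0r.
rewrite bary_comb // (bigD1 k) //= eqxx big1 ?addr0 // => m /negPf -> //.
Qed.

Lemma bary_affine (p : 'I_3 -> pt) i (x y : pt) (e : R) :
  bary p i (x + e *: (y - x)) = bary p i x + e * (bary p i y - bary p i x).
Proof.
have -> : bary p i y = bary p i (x + (y - x)) by rewrite addrC subrK.
by rewrite !baryD !dotE !mxE; ring.
Qed.

End Triangle.

Section Mesh.
Context {R : realType} (T : mesh R).
Local Notation pt := 'cV[R]_2.
Hypothesis nondeg : forall K : 'I_(nelt T), tri_det (evert K) != 0.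
Local Notation baryK K := (bary (evert (T := T) K)).

Lemma elt_inj (K : 'I_(nelt T)) : injective (elt K).
Proof.
move=> i k e; have := bary_vertex i i (nondeg K).
have -> : evert K i = evert K k by rewrite /evert e.
by rewrite bary_vertex // eqxx; case: eqP => // _ /esym /eqP; rewrite oner_eq0.
Qed.

Lemma elt_vset (K : 'I_(nelt T)) m : elt K m \in vset K.
Proof. by rewrite inE codom_f. Qed.

Lemma sum_vset (V : nmodType) (K : 'I_(nelt T)) (G : 'I_(nvert T) -> V) :
  (forall v, v \notin vset K -> G v = 0) -> \sum_v G v = \sum_m G (elt K m).
Proof.
move=> G0; rewrite (bigID (mem (vset K))) /= [X in _ + X]big1 // addr0.
transitivity (\sum_(v in [set elt K m | m in 'I_3]%SET) G v).
  apply: eq_bigl => v; rewrite inE; apply/codomP/imsetP => -[m].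
    by move=> ->; exists m.
  by move=> _ ->; exists m.
by rewrite big_imset //= => i k _ _; apply: elt_inj.
Qed.

(** By uniqueness, the barycentric coordinates are the weights of the convex combination. *)
Lemma chull_bary (K : 'I_(nelt T)) (S : {set 'I_(nvert T)}) x :
  S \subset vset K ->
  chull (@vert _ T) S x ->
  forall m, 0 <= baryK K m x /\ (elt K m \notin S -> baryK K m x = 0).
Proof.
move=> /fintype.subsetP SK [l [l0 lS l1 xE]] m.
have lK v : v \notin vset K -> l v = 0.
  by move=> vK; apply: lS; apply: contra vK => /SK.
have -> : x = \sum_m l (elt K m) *: evert K m.
  by rewrite xE (sum_vset (K := K)) // => v /lK ->; rewrite scale0r.
rewrite (bary_comb (t := fun m => l (elt K m))) //.
  by split=> [|/lS]; first exact: l0.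
by rewrite -(sum_vset lK).
Qed.

Lemma tri_baryP (K : 'I_(nelt T)) x :
  tri K x <-> forall m, 0 <= baryK K m x.
Proof.
split=> [xK m|x0]; first by have [] := chull_bary (subxx _) xK m.
(* The coordinates, extended by zero to the vertices outside [K]. *)
exists (fun v => \sum_m (elt K m == v)%:R * baryK K m x).
have E m : \sum_m0 (elt K m0 == elt K m)%:R * baryK K m0 x = baryK K m x.
  rewrite (bigD1 m) //= eqxx mul1r big1 ?addr0 // => i im.
  by rewrite (inj_eq (@elt_inj K)) (negPf im) mul0r.
have E0 v : v \notin vset K -> \sum_m (elt K m == v)%:R * baryK K m x = 0.
  move=> vK; rewrite big1 // => m _; case: eqP vK => [<-|]; rewrite ?mul0r //.
  by rewrite elt_vset.
split=> //.
- by move=> v; rewrite sumr_ge0 // => m _; rewrite mulr_ge0.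
- rewrite (sum_vset (K := K)) // -[RHS](bary_sum x (nondeg K)).
  by apply: eq_bigr => m _; rewrite E.
- rewrite (sum_vset (K := K)) => [|v /E0 ->]; last by rewrite scale0r.
  rewrite -[LHS](bary_point x (nondeg K)).
  by apply: eq_bigr => m _; rewrite E.
Qed.

End Mesh.

(** * Small displacements and the elements they reach *)

Section Ray.
Context {R : realType}.
Local Notation pt := 'cV[R]_2.

Lemma near0_gt (a b : R) : 0 < a -> \forall e \near (0 : R), 0 < a + e * b.
Proof.
move=> a0; have : (a + e * b) @[e --> (0 : R)] --> a + 0 * b.
  by apply: cvgD; [exact: cvg_cst|apply: cvgM; [exact: cvg_id|exact: cvg_cst]].
by rewrite mul0r addr0 => /cvgr_gt; apply.
Qed.

Lemma near0_right_gt (a b : R) : 0 < a -> \forall e \near 0^'+, 0 < a + e * b.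
Proof.
by move=> a0; apply: cvg_at_right_filter (near0_gt b a0); exact: cvg_id.
Qed.

Lemma near0_open (O : set pt) p d : open O -> O p ->
  \forall e \near 0^'+, O (p + e *: d).
Proof.
move=> oO Op.
have : (p + e *: d) @[e --> (0 : R)^'+] --> p + 0 *: d.
  apply: cvg_at_right_filter; apply: cvgD; first exact: cvg_cst.
  by apply: cvgZ; [exact: cvg_id|exact: cvg_cst].
rewrite scale0r addr0; apply; exact: open_nbhs_nbhs.
Qed.

End Ray.

Section Interior.
Context {R : realType} (Omega : set 'cV[R]_2) (T : mesh R).
Local Notation pt := 'cV[R]_2.
Hypothesis oO : open Omega.
Hypothesis trO : triangulation Omega T.
Local Notation baryK K := (bary (evert (T := T) K)).

Lemma tri_det_neq0 (K : 'I_(nelt T)) : tri_det (evert K) != 0.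
Proof. by case: trO. Qed.

Lemma interior_vertex j : ~ bdry Omega (@vert _ T j) -> Omega (vert j).
Proof.
move=> nb; have [_ cov _ clO _] := trO; have [K jK] := cov j.
rewrite -((interior_id Omega).1 oO); apply: contrapT => ni; apply: nb.
split=> //.
rewrite clO; exists K => //.
exists (fun i => (i == j)%:R); split => //.
- by move=> i iK; case: eqP iK => // ->; rewrite jK.
- by rewrite (bigD1 j) //= eqxx big1 ?addr0 // => i /negPf ->.
- rewrite (bigD1 j) //= eqxx scale1r big1 ?addr0 // => i /negPf ->.
  by rewrite scale0r.
Qed.

(* The elements missing p, being closed and finitely many, also miss a
   neighbourhood of p. *)
Lemma ray_elt p d : Omega p -> exists K e,
  [/\ 0 < e, @tri _ T K p & tri K (p + e *: d)].
Proof.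
move=> Op.
have H : \forall e \near (0 : R)^'+, forall K m,
    baryK K m p < 0 -> baryK K m (p + e *: d) < 0.
  apply: filter_forall => K; apply: filter_forall => m.
  case: (ltP (baryK K m p) 0) => [lt0|_]; last exact: nearW.
  have : 0 < - baryK K m p by rewrite oppr_gt0.
  move=> /(near0_right_gt (- dot (gbary (evert K) m) d)).
  apply: filterS => e He _; rewrite baryD dotZr.
  by move: He; lra.
near (0 : R)^'+ => e.
have e0 : 0 < e by near: e; exact: nbhs_right_gt.
have Oe : Omega (p + e *: d) by near: e; exact: near0_open.
have He : forall K m, baryK K m p < 0 -> baryK K m (p + e *: d) < 0 by near: e.
have [_ _ _ clO _] := trO.
have [K _ xK] : (\bigcup_K @tri _ T K) (p + e *: d).
  by rewrite -clO; exact: subset_closure.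
exists K, e; split => //; apply/(tri_baryP tri_det_neq0) => m.
rewrite leNgt; apply/negP => /He; rewrite ltNge => /negP; apply.
by have /(tri_baryP tri_det_neq0) := xK.
Unshelve. all: by end_near.
Qed.

(** By conformity a common point lies in the hull of the common vertices, so its coordinates at all
    other vertices of [K] vanish. *)
Lemma common_bary (K K' : 'I_(nelt T)) x m : K != K' -> tri K x -> tri K' x ->
  0 < baryK K m x -> elt K m \in vset K'.
Proof.
move=> KK' xK xK' m0; have [_ _ _ _ /(_ _ _ KK')[_ E]] := trO.
have xI : (tri K `&` tri K') x by [].
move: xI; rewrite E => xI.
have [_] := chull_bary tri_det_neq0 (finset.subsetIl _ _) xI m.
rewrite inE elt_vset /= => H; apply: contraTT m0 => /H ->.
by rewrite ltxx.
Qed.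

Lemma closed_bdry (S : {set 'I_(nvert T)}) :
  (forall K m m', elt K m \in S -> elt K m' \in S) -> S != finset.set0 ->
  exists2 j, j \in S & bdry Omega (@vert _ T j).
Proof.
move=> Scl /set0Pn[j0 j0S].
case: (arg_maxP (fun j => @vert _ T j 0 0) j0S) => j jS jmax.
exists j => //; apply: contrapT => /interior_vertex Oj.
have [K [e [e0 pK qK]]] := ray_elt (delta_mx 0 0) Oj.
have [K0 jK0] : exists K, j \in vset K by case: trO.
(* So far [K] only contains the point [vert j]; conformity makes [j] one of its vertices. *)
have jK : j \in vset K.
  have [<- //|KK] := eqVneq K0 K.
  move: jK0; rewrite inE => /codomP[m jE]; rewrite jE.
  have jv : vert j = evert K0 m by rewrite jE.
  apply: (common_bary (x := vert j) KK) => //; last first.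
    by rewrite jv bary_vertex ?eqxx // tri_det_neq0.
  apply/(tri_baryP tri_det_neq0) => m'.
  by rewrite jv bary_vertex ?ler0n // tri_det_neq0.
have KS m : elt K m \in S.
  move: jK; rewrite inE => /codomP[m' jE].
  by apply: (Scl K m'); rewrite -jE.
move/(tri_baryP tri_det_neq0): qK; set q := vert j + _ => qK.
(* The abscissa of [q] is a convex combination of abscissas of vertices in [S], yet [q] lies at
   distance [e] to the right of [vert j]. *)
have : q 0 0 <= vert j 0 0.
  have /(congr1 (fun x : pt => x 0 0)) := bary_point q (tri_det_neq0 K).
  rewrite summxE => <-.
  rewrite -[leRHS]mul1r -[in leRHS](bary_sum q (tri_det_neq0 K)) mulr_suml.
  apply: ler_sum => m _; rewrite !mxE; apply: ler_wpM2l => //.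
  exact: jmax (KS m).
rewrite /q !mxE /= mulr1; lra.
Qed.

End Interior.

(** * Elements on the two sides of an edge *)

Section Edge.
Context {R : realType}.
Local Notation pt := 'cV[R]_2.

Lemma ord3_third (i j : 'I_3) : i != j -> exists k, uniq [:: i; j; k].
Proof.
by elim/ord3_ind: i; elim/ord3_ind: j => // _;
  do [by exists 0 | by exists 1 | by exists 2].
Qed.

Lemma ord3_mem (i j k m : 'I_3) : uniq [:: i; j; k] ->
  [\/ m = i, m = j | m = k].
Proof.
case/uniq_ord3=> -[-> ->]; elim/ord3_ind: i; elim/ord3_ind: m;
  rewrite ?ord3_addE;
  do [exact: Or31 | exact: Or32 | exact: Or33].
Qed.

(** Areas over the common base from [i] to [j]: the sign of the coordinate at [k] tells on which
    side of that line [x] lies. *)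
Lemma bary_cross (p : 'I_3 -> pt) i j k x : tri_det p != 0 ->
  uniq [:: i; j; k] ->
  bary p k x * cross (p j - p i) (p k - p i) = cross (p j - p i) (x - p i).
Proof.
move=> p0 u; rewrite /bary mulrAC; apply: (mulIf p0); rewrite divfK //.
by case/uniq_ord3: u => -[-> ->]; move: i; apply: ord3_ind;
  rewrite ?ord3_addE tri_detE /cross !mxE; ring.
Qed.

Lemma cross_tri_neq0 (p : 'I_3 -> pt) i j k : tri_det p != 0 ->
  uniq [:: i; j; k] -> cross (p j - p i) (p k - p i) != 0.
Proof.
move=> p0 u; have u' : uniq [:: j; k; i] by rewrite -(rot_uniq 1) in u.
by rewrite -normr_eq0 (cross_norm _ u') normr_eq0.
Qed.
End Edge.

Section InteriorEdge.
Context {R : realType} (Omega : set 'cV[R]_2) (T : mesh R).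
Local Notation pt := 'cV[R]_2.
Hypothesis oO : open Omega.
Hypothesis trO : triangulation Omega T.
Local Notation baryK K := (bary (evert (T := T) K)).

Let nd := tri_det_neq0 trO.

Lemma card_vset (K : 'I_(nelt T)) : #|vset K| = 3%N.
Proof. by rewrite cardsE card_codom ?card_ord //; exact: elt_inj. Qed.

(** Starting at a point of the edge close to the interior endpoint, a small move away from vertex
    [k] leaves [K] and ends in another element through that point. Both endpoints have positive
    coordinates there, so conformity makes them vertices of that element. *)
Lemma edge_other (K : 'I_(nelt T)) i j : Omega (evert K i) -> i != j ->
  exists K', [/\ K' != K, elt K i \in vset K' & elt K j \in vset K'].
Proof.
move=> Oi ij; have [k u] := ord3_third ij.
have [ik jk] : i != k /\ j != k.
  by move: u; rewrite /= !inE negb_or => /and3P[/andP[_ ->] -> _].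
near (0 : R)^'+ => t.
have t0 : 0 < t by near: t; exact: nbhs_right_gt.
have t1 : t < 1 by near: t; exact: nbhs_right_lt.
pose p := evert K i + t *: (evert K j - evert K i).
have Op : Omega p by rewrite /p; near: t; exact: near0_open.
have bp m : baryK K m p = (m == i)%:R + t * ((m == j)%:R - (m == i)%:R).
  by rewrite /p bary_affine !bary_vertex.
have [K' [e [e0 pK' qK']]] := ray_elt oO trO (evert K i - evert K k) Op.
have pK : tri K p.
  apply/(tri_baryP nd) => m; rewrite bp; case: eqP => [->|_].
    by rewrite (negPf ij) sub0r mulrN1 /=; lra.
  by rewrite add0r subr0 mulr_ge0 // ltW.
have KK' : K != K'.
  apply: contraTneq e0 => KE; move: qK'; rewrite -KE => /(tri_baryP nd) /(_ k).
  (* The [k]-th coordinate falls from 1 at vertex [k] to 0 at vertex [i], so its slope in this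
     direction is -1; starting from 0 on the edge it becomes [- e]. *)
  have := baryD (evert K) k (evert K k) (evert K i - evert K k).
  rewrite addrC subrK !bary_vertex // eqxx (eq_sym k i) (negPf ik) => g.
  rewrite baryD dotZr bp (eq_sym k) (negPf ik) (eq_sym k) (negPf jk) -leNgt.
  by move: g => /=; nra.
exists K'; split; first by rewrite eq_sym.
  by apply: (common_bary trO KK' pK) => //; rewrite bp eqxx (negPf ij) /=; lra.
apply: (common_bary trO KK' pK) => //.
by rewrite bp eqxx eq_sym (negPf ij) /=; lra.
Unshelve. all: by end_near.
Qed.

(* Otherwise both elements contain points of the segment from the midpoint of
   the edge to evert K k, which conformity excludes. *)
Lemma edge_opposite (K K' : 'I_(nelt T)) i j k i' j' k' :
  interior_edge K K' i j k i' j' k' ->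
  cross (evert K j - evert K i) (evert K k - evert K i) *
  cross (evert K j - evert K i) (evert K' k' - evert K i) < 0.
Proof.
move=> [KK' u u' ei ej].
have pi : evert K' i' = evert K i by rewrite /evert ei.
have pj : evert K' j' = evert K j by rewrite /evert ej.
have c0 := cross_tri_neq0 (nd K) u.
have := cross_tri_neq0 (nd K') u'; rewrite pi pj => c'0.
have [ij ik jk] : [/\ i != j, i != k & j != k].
  by move: u; rewrite /= !inE negb_or => /and3P[/andP[-> ->] -> _].
have [ij' ik' jk'] : [/\ i' != j', i' != k' & j' != k'].
  by move: u'; rewrite /= !inE negb_or => /and3P[/andP[-> ->] -> _].
rewrite ltNge le_eqVlt eq_sym mulf_eq0 (negPf c0) (negPf c'0) /=.
apply/negP => c2.
pose mid := evert K i + 2^-1 *: (evert K j - evert K i).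
have bmid m : baryK K m mid = (m == i)%:R + 2^-1 * ((m == j)%:R - (m == i)%:R).
  by rewrite /mid bary_affine !bary_vertex.
have bmid' m : baryK K' m mid =
    (m == i')%:R + 2^-1 * ((m == j')%:R - (m == i')%:R).
  by rewrite /mid -pi -pj bary_affine !bary_vertex.
(* If [k] and [k'] are on the same side, moving from [mid] towards [evert K k] increases the [k']-th
   coordinate, while the other two stay close to one half. *)
have b0 : 0 < baryK K' k' (evert K k).
  have /(congr1 ( *%R (cross (evert K j - evert K i)
                             (evert K k - evert K i)))) :=
    bary_cross (evert K k) (nd K') u'.
  rewrite pi pj mulrCA -expr2 => E.
  by rewrite -(pmulr_lgt0 _ c2) E exprn_even_gt0.
near (0 : R)^'+ => e.
have e0 : 0 < e by near: e; exact: nbhs_right_gt.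
have e1 : e < 1 by near: e; exact: nbhs_right_lt.
have ei' : 0 < 2^-1 + e * (baryK K' i' (evert K k) - 2^-1).
  by near: e; apply: near0_right_gt; rewrite invr_gt0.
have ej' : 0 < 2^-1 + e * (baryK K' j' (evert K k) - 2^-1).
  by near: e; apply: near0_right_gt; rewrite invr_gt0.
pose x := mid + e *: (evert K k - mid).
have bk : baryK K k x = e.
  rewrite /x bary_affine bary_vertex // bmid eqxx.
  by rewrite (eq_sym k) (negPf ik) (eq_sym k) (negPf jk) /=; lra.
have xK : tri K x.
  apply/(tri_baryP nd) => m; have [->|->|->] := ord3_mem m u.
  - rewrite /x bary_affine bary_vertex // bmid eqxx.
    by rewrite (negPf ij) (negPf ik) /=; lra.
  - rewrite /x bary_affine bary_vertex // bmid eqxx.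
    by rewrite (eq_sym j) (negPf ij) (negPf jk) /=; lra.
  - by rewrite bk ltW.
have xK' : tri K' x.
  apply/(tri_baryP nd) => m; rewrite /x bary_affine bmid'.
  have [->|->|->] := ord3_mem m u'.
  - rewrite eqxx (negPf ij') /=; move: ei'; lra.
  - by rewrite eqxx eq_sym (negPf ij') /=; move: ej'; lra.
  - rewrite (eq_sym k') (negPf ik') (eq_sym k') (negPf jk') /=.
    by have := mulr_gt0 e0 b0; lra.
(* Now all three vertices of [K] belong to [K'], although distinct elements have distinct vertex
   sets. *)
have kK' : elt K k \in vset K' by apply: (common_bary trO KK' xK); rewrite ?bk.
have [_ _ _ _ /(_ _ _ KK')[/eqP[]]] := trO.
apply/eqP; rewrite finset.eqEcard !card_vset leqnn andbT.
apply/fintype.subsetP => v; rewrite inE => /codomP[m ->].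
by have [->|->|->] := ord3_mem m u => //; rewrite ?ei ?ej elt_vset.

Unshelve. all: by end_near.
Qed.
End InteriorEdge.

(** * Signs of the assembled off-diagonal sums *)

Section OffDiag.
Context {R : realType} (Omega : set 'cV[R]_2) (T : mesh R).
Local Notation pt := 'cV[R]_2.
Hypothesis oO : open Omega.
Hypothesis trO : triangulation Omega T.

Lemma edge_positions (K K' : 'I_(nelt T)) i j : K != K' -> i != j ->
  elt K i \in vset K' -> elt K j \in vset K' ->
  exists k i' j' k', interior_edge K K' i j k i' j' k'.
Proof.
rewrite !inE => KK' ij /codomP[i' ei] /codomP[j' ej].
have ij' : i' != j'.
  apply: contraNneq ij => E; apply/eqP/(@elt_inj _ _ (tri_det_neq0 trO) K).
  by rewrite ei ej E.
have [[k u] [k' u']] := (ord3_third ij, ord3_third ij').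
by exists k, i', j', k'.
Qed.

(** Three elements on one edge would have third vertices pairwise on opposite sides of a line, that
    is, three real numbers with pairwise negative products. *)
Lemma edge_two_elts (K K' K'' : 'I_(nelt T)) i j : i != j -> K != K' ->
  elt K i \in vset K' -> elt K j \in vset K' ->
  elt K i \in vset K'' -> elt K j \in vset K'' -> K'' = K \/ K'' = K'.
Proof.
move=> ij KK' iK' jK' iK'' jK''.
have [->|K1] := eqVneq K'' K; first by left.
have [->|K2] := eqVneq K'' K'; first by right.
rewrite eq_sym in K1; rewrite eq_sym in K2.
have [k [i' [j' [k' E1]]]] := edge_positions KK' ij iK' jK'.
have [l [i'' [j'' [l'' E2]]]] := edge_positions K1 ij iK'' jK''.
have E3 : interior_edge K' K'' i' j' k' i'' j'' l''.
  by case: E1 E2 => [_ _ u ei ej] [_ _ u' ei' ej']; split; rewrite // -?ei -?ej.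
have E2' : interior_edge K K'' i j k i'' j'' l''.
  by case: E1 E2 => [_ u _ _ _] [? _ ? ? ?]; split.
have [_ _ _ ei ej] := E1.
move: (edge_opposite trO E1) (edge_opposite trO E2') (edge_opposite trO E3).
rewrite /evert -ei -ej.
set a := cross _ _; set b := cross _ _; set c := cross _ _; clearbody a b c.
move=> ab ac bc; have : 0 < a * b * (a * c) by rewrite nmulr_rgt0.
by rewrite mulrACA -expr2 ltNge mulr_ge0_le0 ?sqr_ge0 // ltW.
Qed.

(** Either no element contains both vertices and the sum is zero, or exactly two do, and their two
    local terms are those of the assumption on [s]. *)
Lemma offdiag_le0 (s : 'I_(nelt T) -> 'I_3 -> 'I_3 -> R) i j :
  (forall K K' i j k i' j' k', interior_edge K K' i j k i' j' k' ->
    s K i j + s K' i' j' <= 0) ->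
  Omega (vert i) -> i != j ->
  \sum_K \sum_l \sum_m (elt K l == i)%:R * (elt K m == j)%:R * s K l m <= 0.
Proof.
move=> hs Oi ij.
have E0 K : ~~ ((i \in vset K) && (j \in vset K)) ->
    \sum_l \sum_m (elt K l == i)%:R * (elt K m == j)%:R * s K l m = 0.
  move=> H; rewrite big1 // => l _; rewrite big1 // => m _.
  case: eqP => [El|]; last by rewrite !mul0r.
  case: eqP => [Em|]; last by rewrite mulr0 mul0r.
  by move: H; rewrite -El -Em !elt_vset.
have E1 K l m : elt K l = i -> elt K m = j ->
    \sum_l \sum_m (elt K l == i)%:R * (elt K m == j)%:R * s K l m = s K l m.
  have inj := @elt_inj _ _ (tri_det_neq0 trO) K.
  move=> El Em; rewrite (bigD1 l) //= [X in _ + X]big1 ?addr0; last first.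
    move=> l' ll'; rewrite big1 // => m' _.
    by rewrite -El (inj_eq inj) (negPf ll') !mul0r.
  rewrite (bigD1 m) //= El Em !eqxx !mul1r big1 ?addr0 // => m' mm'.
  by rewrite -Em (inj_eq inj) (negPf mm') mulr0 mul0r.
have [/existsP[K /andP[iK jK]]|no] :=
  boolP [exists K, (i \in vset K) && (j \in vset K)]; last first.
  rewrite big1 // => K _; rewrite E0 //; apply: contra no => H.
  by apply/existsP; exists K.
move: (iK) (jK); rewrite !inE => /codomP[l El] /codomP[m Em].
have lm : l != m by apply: contraNneq ij => E; rewrite El Em E.
have OK : Omega (evert K l) by rewrite /evert -El.
have [K' [KK' lK' mK']] := edge_other oO trO OK lm.
rewrite eq_sym in KK'.
have [k [l' [m' [k' E]]]] := edge_positions KK' lm lK' mK'.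
have [_ _ _ el em] := E.
rewrite (bigD1 K) //= (bigD1 K') /=; last by rewrite eq_sym.
rewrite (E1 K l m) // (E1 K' l' m') -?el -?em // addrA.
rewrite big1 ?addr0; first exact: hs E.
move=> K'' /andP[n1 n2]; apply: E0; apply/negP => /andP[].
rewrite El Em => l'' m''.
by case: (edge_two_elts lm KK' lK' mK' l'' m'') => F; move: n1 n2;
  rewrite F eqxx.
Qed.
End OffDiag.

(** * Finite element functions and the maximum principle *)

Section FiniteElement.
Context {R : realType} (Omega : set 'cV[R]_2) (T : mesh R).
Local Notation pt := 'cV[R]_2.
Hypothesis trO : triangulation Omega T.
Local Notation baryK K := (bary (evert (T := T) K)).
Variable phi : 'I_(nvert T) -> pt -> R.
Hypothesis hat : hat_functions Omega phi.

Let nd := tri_det_neq0 trO.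

(** An algebraic substitute for the limit in [grad_on]; [fe_grad] shows that they agree. *)
Definition elt_grad (K : 'I_(nelt T)) (c : 'I_(nvert T) -> R) : pt :=
  \sum_m c (elt K m) *: gbary (evert K) m.

Lemma fe_vertex c j : fe_fun phi c (vert j) = c j.
Proof.
rewrite /fe_fun (bigD1 j) //= big1 ?addr0.
  by have [_ _ ->] := hat j; rewrite eqxx mulr1.
by move=> i ij; have [_ _ ->] := hat i; rewrite eq_sym (negPf ij) mulr0.
Qed.

(** Each [phi j] is affine on [K], hence commutes with barycentric combinations. *)
Lemma fe_bary (K : 'I_(nelt T)) c x : tri K x ->
  fe_fun phi c x = \sum_m c (elt K m) * baryK K m x.
Proof.
move=> xK; have vK m : tri K (evert K m).
  by apply/(tri_baryP nd) => i; rewrite bary_vertex // ler0n.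
have E j : phi j x = \sum_m baryK K m x * phi j (evert K m).
  have [_ /(_ K) [p [b pE]] _] := hat j.
  rewrite pE // -{1}(bary_point x (nd K)) dot_sumr.
  rewrite -[b in LHS]mul1r -[X in _ + X * _](bary_sum x (nd K)) mulr_suml.
  by rewrite -big_split; apply: eq_bigr => m _; rewrite pE //= dotZr mulrDr.
rewrite [LHS]/fe_fun; under [LHS]eq_bigr do rewrite E mulr_sumr.
rewrite exchange_big /=; apply: eq_bigr => m _.
rewrite -(fe_vertex c (elt K m)) /fe_fun mulr_suml.
by apply: eq_bigr => j _; rewrite mulrCA mulrC.
Qed.

(** All coordinates of the centroid are 1/3, so small displacements stay in [K], where the function
    is affine and the difference quotient is constant. *)
Lemma fe_grad (K : 'I_(nelt T)) c : grad_on K (fe_fun phi c) = elt_grad K c.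
Proof.
apply/matrixP => i j; rewrite ord1 mxE {j} -[RHS]dot_delta.
set d := delta_mx i 0; set a := centroid _.
have ba m : baryK K m a = 3^-1.
  rewrite /a /centroid scaler_sumr (bary_comb (t := fun=> 3^-1)) //.
  by rewrite sum3; field.
have aK : tri K a by apply/(tri_baryP nd) => m; rewrite ba invr_ge0.
apply: lim_near_cst; first exact: norm_hausdorff.
have H : \forall h \near (0 : R), tri K (h *: d + a).
  have : \forall h \near (0 : R), forall m,
      0 < 3^-1 + h * dot (gbary (evert K) m) d.
    apply: (@filter_forall R _ _ (nbhs (0 : R))) => m.
    by apply: near0_gt; rewrite invr_gt0.
  apply: filterS => h H; apply/(tri_baryP nd) => m.
  by rewrite addrC baryD dotZr ba ltW.
near=> h.
have h0 : h != 0 by near: h; exact: nbhs_dnbhs_neq.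
have hK : tri K (h *: d + a) by near: h; exact: nbhs_dnbhs H.
rewrite /= (fe_bary _ hK) (fe_bary _ aK) -sumrB dot_suml scaler_sumr.
apply: eq_bigr => m _; rewrite [h *: d + a]addrC (baryD _ m a) !dotZr dotZl.
by rewrite /GRing.scale /=; field.
Unshelve. all: by end_near.
Qed.

(** The difference of two vertex values is the gradient paired with the edge vector. *)
Lemma elt_grad_const (K : 'I_(nelt T)) c : elt_grad K c = 0 ->
  forall l m, c (elt K l) = c (elt K m).
Proof.
move=> c0 l m.
have E i : c (elt K i) = \sum_k c (elt K k) * baryK K k (evert K i).
  rewrite (bigD1 i) //= bary_vertex // eqxx mulr1 big1 ?addr0 // => k ki.
  by rewrite bary_vertex // (negPf ki) mulr0.
apply/eqP; rewrite -subr_eq0 !E -sumrB.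
have -> : \sum_i (c (elt K i) * baryK K i (evert K l)
    - c (elt K i) * baryK K i (evert K m)) =
    dot (elt_grad K c) (evert K l - evert K m).
  rewrite dot_suml; apply: eq_bigr => k _.
  have := baryD (evert K) k (evert K m) (evert K l - evert K m).
  by rewrite addrC subrK => ->; rewrite dotZl; ring.
by rewrite c0 /dot trmx0 mul0mx mxE.
Qed.

Lemma elt_gradD (K : 'I_(nelt T)) a b :
  elt_grad K (fun j => a j + b j) = elt_grad K a + elt_grad K b.
Proof.
by rewrite /elt_grad -big_split; apply: eq_bigr => m _; rewrite scalerDl.
Qed.

Lemma elt_grad_cst (K : 'I_(nelt T)) (b : R) : elt_grad K (fun=> b) = 0.
Proof. by rewrite /elt_grad -scaler_sumr sum_gbary scaler0. Qed.

Lemma elt_grad_basis (K : 'I_(nelt T)) c :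
  elt_grad K c = \sum_j c j *: elt_grad K (fun i => (i == j)%:R).
Proof.
rewrite /elt_grad; under [RHS]eq_bigr do rewrite scaler_sumr.
rewrite exchange_big; apply: eq_bigr => m _ /=.
rewrite (bigD1 (elt K m)) //= eqxx scale1r big1 ?addr0 // => j jm.
by rewrite eq_sym (negPf jm) scale0r scaler0.
Qed.

End FiniteElement.

(** * The stiffness form and the discrete maximum principle *)

Section Energy.
Context {R : realType} (Omega : set 'cV[R]_2) (T : mesh R).
Local Notation pt := 'cV[R]_2.
Hypothesis oO : open Omega.
Hypothesis trO : triangulation Omega T.
Variable M : 'I_(nelt T) -> 'M[R]_2.
Hypothesis spdM : forall K, spd (M K).

(** The bilinear form of the scheme on nodal values; the second argument is the test function. *)
Definition energy (c e : 'I_(nvert T) -> R) : R :=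
  \sum_K area K * dot (elt_grad K e) (M K *m elt_grad K c).

Hypothesis edge_le0 : forall K K' i j k i' j' k',
  interior_edge (T := T) K K' i j k i' j' k' ->
  area K * dot (gbary (evert K) i) (M K *m gbary (evert K) j) +
  area K' * dot (gbary (evert K') i') (M K' *m gbary (evert K') j') <= 0.

Lemma energy_offdiag i j : Omega (vert i) -> i != j ->
  energy (fun v => (v == j)%:R) (fun v => (v == i)%:R) <= 0.
Proof.
move=> Oi ij; apply: le_trans (offdiag_le0 oO trO edge_le0 Oi ij).
rewrite le_eqVlt; apply/orP; left; apply/eqP; apply: eq_bigr => K _.
rewrite dot_bilin mulr_sumr; apply: eq_bigr => l _.
by rewrite mulr_sumr; apply: eq_bigr => m _; rewrite mulrCA.
Qed.

Lemma area_gt0 (K : 'I_(nelt T)) : 0 < area K.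
Proof. by rewrite divr_gt0 // normr_gt0 (tri_det_neq0 trO). Qed.

(** In the expansion over the stiffness matrix, disjoint supports remove the diagonal and the
    boundary values of [a] remove the boundary rows; only entries covered by [energy_offdiag]
    remain. *)
Lemma energy_cross (a b : 'I_(nvert T) -> R) :
  (forall j, 0 <= a j) -> (forall j, 0 <= b j) -> (forall j, a j * b j = 0) ->
  (forall j, bdry Omega (vert j) -> a j = 0) -> energy b a <= 0.
Proof.
move=> a0 b0 ab a_bdry.
have -> : energy b a = \sum_i \sum_j a i * b j *
    energy (fun v => (v == j)%:R) (fun v => (v == i)%:R).
  rewrite /energy.
  under eq_bigr => K _ do rewrite (elt_grad_basis K a) (elt_grad_basis K b)
    dot_bilin mulr_sumr.
  rewrite exchange_big; apply: eq_bigr => i _ /=.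
  under eq_bigr => K _ do rewrite mulr_sumr.
  rewrite exchange_big; apply: eq_bigr => j _ /=.
  by rewrite mulr_sumr; apply: eq_bigr => K _; rewrite mulrCA.
apply: sumr_le0 => i _; apply: sumr_le0 => j _.
have [->|ij] := eqVneq i j; first by rewrite ab mul0r.
have [ib|/(interior_vertex oO trO) Oi] := pselect (bdry Omega (vert i)).
  by rewrite a_bdry // !mul0r.
by rewrite mulr_ge0_le0 ?mulr_ge0 // energy_offdiag.
Qed.

Lemma energy_max (c : 'I_(nvert T) -> R) (m : R) :
  (forall j, bdry Omega (vert j) -> c j <= m) ->
  energy c (fun j => Num.max (c j - m) 0) <= 0 -> forall j, c j <= m.
Proof.
move=> c_bdry en0; pose e j := Num.max (c j - m) 0.
(* The negative part of [c - m], so that [e] and [n] have disjoint supports. *)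
pose n j := e j + (m - c j).
have e0 j : 0 <= e j by rewrite le_max lexx orbT.
have n0 j : 0 <= n j.
  by rewrite -lerBlDr sub0r opprB /e le_max lexx.
have en j : e j * n j = 0.
  by rewrite /n /e; case: (leP (c j - m) 0) => _; rewrite ?mul0r //; ring.
have e_bdry j : bdry Omega (vert j) -> e j = 0.
  by move=> /c_bdry cm; apply/max_idPr; rewrite subr_le0.
(* Here [e = c + n - m], and the constant [m] has no gradient. *)
have cE K : elt_grad K e = elt_grad K c + elt_grad K n.
  rewrite -elt_gradD -[LHS]addr0 -(elt_grad_cst K m) -elt_gradD.
  by apply: eq_bigr => l _; congr (_ *: _); rewrite /n; ring.
have ee0 : energy e e <= 0.
  have -> : energy e e = energy c e + energy n e.
    rewrite /energy -big_split; apply: eq_bigr => K _ /=.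
    by rewrite -mulrDr [in X in M K *m X]cE mulmxDr /dot mulmxDr mxE.
  by have := energy_cross e0 n0 en e_bdry; move: en0; rewrite -/e; lra.
have t0 K : 0 <= area K * dot (elt_grad K e) (M K *m elt_grad K e).
  have [->|g0] := eqVneq (elt_grad K e) 0.
    by rewrite mulmx0 /dot mulmx0 mxE mulr0.
  by rewrite mulr_ge0 // ltW ?area_gt0 //; apply: (spdM K).2.
have g0 K : elt_grad K e = 0.
  have /psumr_eq0P z : energy e e = 0.
    by apply: le_anti; rewrite ee0 sumr_ge0.
  apply: contrapT => /eqP gK; have /eqP := z (fun K _ => t0 K) K isT.
  by rewrite mulf_eq0 !gt_eqF ?area_gt0 //; apply: (spdM K).2.
pose S : {set 'I_(nvert T)} := finset (fun j => 0 < e j).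
have [S0|S0] := eqVneq S finset.set0.
  move=> j; have : j \notin S by rewrite S0 inE.
  by rewrite inE -leNgt /e ge_max => /andP[+ _]; rewrite subr_le0.
have Scl K l k : elt K l \in S -> elt K k \in S.
  by rewrite !inE (elt_grad_const trO (g0 K) l k).
have [j jS /e_bdry ej] := closed_bdry oO trO Scl S0.
by move: jS; rewrite inE ej ltxx.
Qed.

End Energy.

Theorem theorem4p1 (R : realType) (Omega : set 'cV[R]_2)
    (D : 'cV[R]_2 -> 'M[R]_2) (f g : 'cV[R]_2 -> R)
    (T : mesh R) (phi : 'I_(nvert T) -> 'cV[R]_2 -> R)
    (Q : quadrature R) (F : 'I_(nelt T) -> 'cV[R]_2 -> 'cV[R]_2) :
  polygonal_domain Omega ->
  triangulation Omega T ->
  hat_functions Omega phi ->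
  quadrature_rule Q ->
  element_maps Q F ->
  (forall x, Omega x -> spd (D x)) ->
  (forall K (k : 'I_(nnode Q)), spd (D (node F K k))) ->
  (forall (K K' : 'I_(nelt T)) (i j k i' j' k' : 'I_3),
     interior_edge K K' i j k i' j' k' ->
     let alpha := edge_angle Q F D K i j k in
     let alpha' := edge_angle Q F D K' i' j' k' in
     let d := \det (DK Q F D K) in
     let d' := \det (DK Q F D K') in
     (alpha + alpha' + arccot (Num.sqrt (d / d') * cot alpha)
        + arccot (Num.sqrt (d' / d) * cot alpha')) / 2 <= pi) ->
  DMP Omega phi Q F D f g.
Proof.
move=> [neO oO _ _ _] trO hat [_ Qin w0 w1] FK _ spdD cond _ f0 u.
move=> [[c _ uE] sol].
have nd := tri_det_neq0 trO.
have clO : closure Omega = \bigcup_K @tri _ T K by case: trO.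
have spdK K : spd (DK Q F D K) by exact: spd_convex.
have edge_le0 K K' i j k i' j' k' :
    interior_edge (T := T) K K' i j k i' j' k' ->
    area K * dot (gbary (evert K) i) (DK Q F D K *m gbary (evert K) j) +
    area K' * dot (gbary (evert K') i') (DK Q F D K' *m gbary (evert K') j')
    <= 0.
  move=> E; have [_ un un' _ _] := E.
  rewrite (stiffness_cot (spdK K) (nd K) un).
  rewrite (stiffness_cot (spdK K') (nd K') un').
  have ang L l m n : uniq [:: l; m; n] -> 0 < edge_angle Q F D L l m n < pi.
    move=> ul; apply: (cot_angle _ _).1; first exact: spdK.
    by rewrite -normr_eq0 cross_norm // normr_eq0.
  have det0 L : 0 < \det (DK Q F D L) by case: (spd_coef (spdK L)).
  have := cot_sum_ge0 (ang K _ _ _ un) (ang K' _ _ _ un') (det0 K) (det0 K')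
    (cond _ _ _ _ _ _ _ _ E).
  by rewrite /edge_angle; lra.
have [x Ox] := neO.
have [K0 _ _] : (\bigcup_K @tri _ T K) x by rewrite -clO; exact: subset_closure.
(* Applied to the set of all vertices, [closed_bdry] shows that boundary vertices exist, so the
   boundary maximum is attained. *)
have [jb0 _ jb0b] : exists2 j, j \in finset.setT & bdry Omega (@vert _ T j).
  apply: (closed_bdry oO trO); first by move=> *; rewrite inE.
  by apply/finset.set0Pn; exists (elt K0 0); rewrite inE.
pose B : pred 'I_(nvert T) := fun j => `[< bdry Omega (vert j) >].
have Bj0 : B jb0 by apply/asboolP.
case: (arg_maxP c Bj0) => jb /asboolP jbb jmax.
have cb j : bdry Omega (vert j) -> c j <= c jb by move=> /asboolP; exact: jmax.
have cmax : forall j, c j <= c jb.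
  apply: (energy_max oO trO spdK edge_le0 cb).
  set e := fun j => _.
  have e0 j : 0 <= e j by rewrite le_max lexx orbT.
  have /sol : U0 Omega phi (fe_fun phi e).
    by exists e => // j /cb cj; apply/max_idPr; rewrite subr_le0.
  have -> : energy (DK Q F D) c e = \sum_K area K *
      dot (grad_on K (fe_fun phi e)) (DK Q F D K *m grad_on K u).
    by apply: eq_bigr => K _; rewrite uE !(fe_grad trO hat).
  (* The load is nonpositive: weights are nonnegative, [f] is nonpositive at the nodes, and the test
     function is nonnegative there because nodes lie in [K] and have nonnegative coordinates. *)
  move=> ->; apply: sumr_le0 => K _.
  apply: mulr_ge0_le0; first exact/ltW/(area_gt0 trO).
  apply: sumr_le0 => k _; apply: mulr_le0_ge0; first exact: mulr_ge0_le0.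
  have nK : tri K (node F K k).
    by have [<- _] := FK K; exists (rnode k) => //; exact: Qin.
  rewrite (fe_bary trO hat _ nK); apply: sumr_ge0 => m _.
  by rewrite mulr_ge0 //; move/(tri_baryP nd): nK.
have uv j : u (vert j) = c j by rewrite uE (fe_vertex hat).
(* On each element [u] is a convex combination of its vertex values, so the nodal bound extends to
   the whole closure. *)
have ucl x0 : closure Omega x0 -> u x0 <= c jb.
  rewrite clO => -[K _ xK]; rewrite uE (fe_bary trO hat _ xK).
  rewrite -[leRHS]mulr1 -(bary_sum x0 (nd K)) mulr_sumr.
  apply: ler_sum => m _; apply: ler_wpM2r => //.
  by move/(tri_baryP nd): xK.
split; exists (c jb); split; split.
- by exists (vert jb); [case: jbb|].
- by move=> _ [y yO <-]; exact: ucl.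
- by exists (vert jb).
- by move=> _ [y [yO _] <-]; exact: ucl.
- by exists jb.
- by move=> _ [j _ <-]; rewrite uv.
- by exists jb.
- by move=> _ [j _ <-]; rewrite uv.
Qed.
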